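(* Let $\mathcal L$ be a set of hybrid curves in $\mathbb R^d$ that is nominally well-posed, tail invariant, and closed under concatenation, and let $X\subset\mathbb R^d$ be nonempty and compact. Then the chain recurrent set $\mathcal R(X)$ of $X$ is internally $\mathcal L$-chain recurrent.
   Context: $\mathbb N=\{1,2,\dots\}$; $\mathbb B$ is the closed unit ball. A compact hybrid time domain is a set $E=\bigcup_{i=0}^{J-1}[t_i,t_{i+1}]\times\{i\}$ with $J\in\mathbb N$ and $0=t_0\le t_1\le\dots\le t_J$ real; a hybrid time domain is the union of a nondecreasing sequence $E_1\subset E_2\subset\dots$ of compact hybrid time domains. A hybrid curve is a function $\phi:\mathrm{dom}\,\phi\to\mathbb R^d$ such that $\mathrm{dom}\,\phi$ is a hybrid time domain and $t\mapsto\phi(t,j)$ is continuous on $[t,t']$ whenever $(t,j),(t',j)\in\mathrm{dom}\,\phi$, $t<t'$. It is identified with a set-valued mapping $\mathbb R^2\rightrightarrows\mathbb R^d$ empty-valued outside $\mathrm{dom}\,\phi$. $\mathrm{gph}\,\phi=\{(t,j,x):(t,j)\in\mathrm{dom}\,\phi,\ x=\phi(t,j)\}$; graphical convergence means (Painlevé–Kuratowski) set convergence of graphs in $\mathbb R^{d+2}$. A sequence $\phi_i\in\mathcal L$ is locally eventually bounded if for every $T>0$ there exist $i_0,R>0$ such that $\phi_i(t,j)\in R\mathbb B$ for all $i\ge i_0$ and $(t,j)\in\mathrm{dom}\,\phi_i$ with $t+j\le T$. $\mathcal L$ is nominally well-posed if (i) every graphically convergent and locally eventually bounded sequence of elements of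 $\mathcal L$ has its graphical limit in $\mathcal L$; and (ii) if there is no $\phi\in\mathcal L$ with $\phi(0,0)=x$ for which $\mathrm{dom}\,\phi$ is bounded and $\phi$ is not bounded, then every sequence $\phi_n\in\mathcal L$ with $\phi_n(0,0)\to x$ is locally eventually bounded. For $(s,i)\in\mathrm{dom}\,\phi$ the tail $\phi^{(s,i)}$ has domain $\{(t,j)\in[0,\infty)^2:(s+t,i+j)\in\mathrm{dom}\,\phi\}$ and values $\phi^{(s,i)}(t,j)=\phi(s+t,i+j)$. $\mathcal L$ is tail invariant if $\phi^{(s,i)}\in\mathcal L$ for all $\phi\in\mathcal L$, $(s,i)\in\mathrm{dom}\,\phi$. The concatenation of $\phi_1,\phi_2\in\mathcal L$ at $(s,i)\in\mathrm{dom}\,\phi_1$ with $\phi_1(s,i)=\phi_2(0,0)$ is the mapping equal to $\phi_1(t,j)$ for $(t,j)\in\mathrm{dom}\,\phi_1$, $t+j\le s+i$, and to $\phi_2(t-s,j-i)$ for $(t-s,j-i)\in\mathrm{dom}\,\phi_2$; $\mathcal L$ is closed under concatenation if all such concatenations are in $\mathcal L$. For $\tau,\varepsilon>0$ and a set $\mathcal M$ of hybrid curves, a $(\tau,\varepsilon)$-$\mathcal M$-chain from $x$ to $y$ consists of $k^*\ge1$, points $x=x_0,x_1,\dots,x_{k^*}=y$ in $\mathbb R^d$ and curves $\phi_0,\dots,\phi_{k^*-1}\in\mathcal M$ such that $\phi_k(0,0)=x_k$ and $x_{k+1}\in\phi_k(t_k,j_k)+\varepsilon\mathbb B$ for some $(t_k,j_k)\in\mathrm{dom}\,\phi_k$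 with $t_k+j_k\ge\tau$. It is internal, with respect to a set $K$, if $x,y\in K$ and $\phi_k(t,j)\in K$ for all $(t,j)\in\mathrm{dom}\,\phi_k$ with $0\le t+j\le t_k+j_k$, $0\le k<k^*$. $K$ is internally $\mathcal L$-chain recurrent if for every $x\in K$ and $\tau,\varepsilon>0$ there exists a $(\tau,\varepsilon)$-$\mathcal L$-chain from $x$ to $x$ that is internal with respect to $K$. $\mathcal L|_X:=\{\phi\in\mathcal L:\ \phi(t,j)\in X\ \forall (t,j)\in\mathrm{dom}\,\phi\}$, and $\mathcal R(X)$ is the set of all $x\in X$ such that for every $\tau,\varepsilon>0$ there exists a $(\tau,\varepsilon)$-$\mathcal L|_X$-chain from $x$ to $x$. *)

(* Defs.v *)
From HB Require Import structures.
From mathcomp Require Import all_boot all_order all_algebra.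
From mathcomp Require Import all_classical all_reals all_analysis.

Set Implicit Arguments.
Unset Strict Implicit.
Unset Printing Implicit Defensive.
Import Order.TTheory GRing.Theory Num.Theory numFieldNormedType.Exports.
Local Open Scope classical_set_scope.
Local Open Scope ring_scope.

(* The norm of the library on ['rV[R]_d] is the sup norm: it gives the right
   topology and bounded sets, but not the Euclidean balls. *)
Definition enorm (R : realType) (d : nat) (x : 'rV[R]_d) : R :=
  Num.sqrt (\sum_(i < d) x 0 i ^+ 2).

Definition eball (R : realType) (d : nat) (x : 'rV[R]_d) (r : R)
  : set 'rV[R]_d := [set y | enorm (y - x) <= r].

Section SetConvergence.
Context {T : topologicalType}.
Implicit Types (S : nat -> set T) (C : set T).

Definition inner_limit S : set T :=
  [set x | forall V, nbhs x V -> \forall n \near \oo, S n `&` V !=set0].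

Definition outer_limit S : set T :=
  [set x | forall V, nbhs x V ->
     forall N, exists2 n, (N <= n)%N & S n `&` V !=set0].

Definition PK_converges S C := inner_limit S = C /\ outer_limit S = C.

End SetConvergence.

Section HybridCurves.
Context {R : realType}.

Definition compact_hybrid_time_domain (E : set (R * nat)) :=
  exists (J : nat) (t : nat -> R),
    [/\ (0 < J)%N, t 0%N = 0, (forall i, (i < J)%N -> t i <= t i.+1) &
      E = \bigcup_(i in `I_J) (`[t i, t i.+1]%classic `*` [set i])].

Definition hybrid_time_domain (E : set (R * nat)) :=
  exists En : nat -> set (R * nat),
    [/\ forall n, compact_hybrid_time_domain (En n),
        forall n, En n `<=` En n.+1 & E = \bigcup_n En n].

Context {d : nat}.

(* Partial functions of (t, j); [None] outside the domain, so that two curves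
   are equal exactly when they have the same graph. *)
Definition hcurve := R -> nat -> option 'rV[R]_d.
Implicit Types (phi : hcurve) (L M : set hcurve) (K X : set 'rV[R]_d).

Definition hdom phi : set (R * nat) := [set p | phi p.1 p.2 != None].

(* Only meaningful on the domain; the value 0 outside is a dummy. *)
Definition hval phi (t : R) (j : nat) : 'rV[R]_d := odflt 0 (phi t j).

Definition hrange phi : set 'rV[R]_d :=
  [set x | exists t j, phi t j = Some x].

Definition gph phi : set (R * R * 'rV[R]_d) :=
  [set q | exists t j x, phi t j = Some x /\ q = (t, j%:R, x)].

Definition hybrid_curve phi :=
  hybrid_time_domain (hdom phi) /\
  forall t t' j, t < t' -> hdom phi (t, j) -> hdom phi (t', j) ->
    {within `[t, t'], continuous (fun s => hval phi s j)}.

Definition bounded_domain phi :=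
  bounded_set [set ((p.1, p.2%:R) : R * R) | p in hdom phi].

Definition bounded_curve phi := bounded_set (hrange phi).

Definition locally_eventually_bounded (phi : nat -> hcurve) :=
  forall T : R, 0 < T -> exists (i0 : nat) (r : R), 0 < r /\
    forall i, (i0 <= i)%N -> forall t j x, phi i t j = Some x ->
      t + j%:R <= T -> eball 0 r x.

Definition nominally_well_posed L :=
  (forall (phi : nat -> hcurve) (G : set (R * R * 'rV[R]_d)),
     (forall n, L (phi n)) -> locally_eventually_bounded phi ->
     PK_converges (fun n => gph (phi n)) G ->
     exists2 psi, L psi & gph psi = G) /\
  (forall x,
     ~ (exists phi, [/\ L phi, phi 0 0%N = Some x, bounded_domain phi &
                        ~ bounded_curve phi]) ->
     forall phi : nat -> hcurve, (forall n, L (phi n)) ->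
       (fun n => hval (phi n) 0 0%N) @ \oo --> x ->
       locally_eventually_bounded phi).

Definition tail phi (s : R) (i : nat) : hcurve := fun t j =>
  if 0 <= t then phi (s + t) (i + j)%N else None.

Definition tail_invariant L :=
  forall phi s i, L phi -> hdom phi (s, i) -> L (tail phi s i).

(* If phi2 starts at phi1(s,i), the two pieces overlap only at (s,i), where
   they agree; the guard [i <= j] excludes the truncation of [j - i]. *)
Definition concatenation phi1 phi2 (s : R) (i : nat) : hcurve := fun t j =>
  if t + j%:R <= s + i%:R then phi1 t j
  else if (i <= j)%N then phi2 (t - s) (j - i)%N else None.

Definition closed_under_concatenation L :=
  forall phi1 phi2 s i, L phi1 -> L phi2 -> hdom phi1 (s, i) ->
    phi1 s i = phi2 0 0%N -> L (concatenation phi1 phi2 s i).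

(* The chain consists of xs k for k <= n, and phis k, (ts k, js k) for k < n. *)
Definition is_chain M (tau eps : R) (x y : 'rV[R]_d) (n : nat)
    (xs : nat -> 'rV[R]_d) (phis : nat -> hcurve) (ts : nat -> R)
    (js : nat -> nat) :=
  [/\ (0 < n)%N, xs 0%N = x, xs n = y &
    forall k, (k < n)%N ->
      [/\ M (phis k), phis k 0 0%N = Some (xs k), hdom (phis k) (ts k, js k),
          tau <= ts k + (js k)%:R &
          eball (hval (phis k) (ts k) (js k)) eps (xs k.+1)]].

Definition is_internal K (x y : 'rV[R]_d) (n : nat) (phis : nat -> hcurve)
    (ts : nat -> R) (js : nat -> nat) :=
  [/\ K x, K y &
    forall k, (k < n)%N -> forall s i z, phis k s i = Some z ->
      0 <= s + i%:R <= ts k + (js k)%:R -> K z].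

Definition chain_exists M (tau eps : R) (x y : 'rV[R]_d) :=
  exists n xs phis ts js, is_chain M tau eps x y n xs phis ts js.

Definition internal_chain_exists K M (tau eps : R) (x y : 'rV[R]_d) :=
  exists n xs phis ts js,
    is_chain M tau eps x y n xs phis ts js /\
    is_internal K x y n phis ts js.

Definition internally_chain_recurrent L K :=
  forall x, K x -> forall tau eps : R, 0 < tau -> 0 < eps ->
    internal_chain_exists K L tau eps x x.

Definition restrict_to L X : set hcurve :=
  [set phi | L phi /\ forall t j z, phi t j = Some z -> X z].

Definition chain_recurrent_set L X : set 'rV[R]_d :=
  [set x | X x /\ forall tau eps : R, 0 < tau -> 0 < eps ->
     chain_exists (restrict_to L X) tau eps x x].

End HybridCurves.

Arguments hcurve : clear implicits.

(* Main.v *)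
Require Import Defs.
From HB Require Import structures.
From mathcomp Require Import all_boot all_order all_algebra.
From mathcomp Require Import all_classical all_reals all_analysis.
Import Order.TTheory GRing.Theory Num.Theory numFieldNormedType.Exports.
From mathcomp Require Import lra.
From Stdlib Require Import Relations.
Local Open Scope classical_set_scope.
Local Open Scope ring_scope.

Set Implicit Arguments.
Unset Strict Implicit.
Unset Printing Implicit Defensive.

(** Fix [M], the curves of [L] that stay in [X].  A point of [R(X)] lies on
    cyclic chains of [M]-curves with arbitrarily long pieces and arbitrarily
    small jumps, but at first nothing says that the pieces themselves stay in
    [R(X)].  The proof replaces each piece by a limit of such pieces and shows
    that these limits do.

    Compactness.  Let [U] be an ultrafilter on an index set.  Everything that
    lives in a compact set converges along [U], and so do sets: the points all
    of whose neighbourhoods are met by [U]-almost all sets of a family form the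
    [U]-limit [ulim U S] of that family.  The graph space is second countable,
    so a sequence of indices can be chosen along which graphs converge to
    their [U]-limit in the sense of Painleve and Kuratowski
    ([PK_converges_ulim]).  Well-posedness then makes the [U]-limit of the
    graphs of curves of [M] the graph of a curve of [M]; local boundedness is
    automatic as [X] is bounded.  Hence arcs of [M]-curves of bounded length,
    the n-th one inside [K n], converge along [U] to an arc of an [M]-curve
    inside [ulim U K] ([arc_ulim]).  Lengths have to be bounded for the end
    times to converge, so the long pieces of a chain are first cut into pieces
    of length between [tau] and [2 tau + 1] ([chain_chop]); tail invariance
    makes this possible.

    Limits of points on cycles are chain recurrent.  Let [y] be a limit of
    points [y'] on cycles with ever longer pieces and ever smaller jumps.  The
    part of a piece that lies after [y'] may be too short to be a piece by
    itself, and one cannot simply start a curve at [y] that follows it.  But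
    that remainder and the next piece of the cycle form two arcs that almost
    match; in the limit they match exactly and their concatenation is a single
    long arc which starts at [y] ([chain_from_limit]).  The same argument with
    the piece before [y'] gives an arc that ends at [y] ([chain_to_limit]).
    Splicing both into the cycle gives a chain from [y] to [y]
    ([chain_recurrent_limit_on_cycle]).

    Conclusion.  If some tolerance [eps] could not be met by replacing pieces
    of ever finer cycles by arcs inside [R(X)], a [U]-limit of the offending
    pieces would be a contradiction: it is an arc whose points are limits of
    points on cycles, hence lie in [R(X)], and its end points are close to
    those of the pieces ([arc_shadow]).  So every piece of a fine enough cycle
    through [x] has a nearby arc inside [R(X)], and these arcs form the
    internal chain ([chain_recurrent_internal]). *)

(** * Limits along an ultrafilter *)

Lemma compact_ultra_cvg (I : Type) (U : set_system I) (T : topologicalType)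
    (A : set T) (f : I -> T) :
  UltraFilter U -> compact A -> (forall i, A (f i)) ->
  exists2 l, A l & f @ U --> l.
Proof.
move=> UU cA Af.
have fA : U (f @^-1` A) by apply: (filterS _ filterT) => i _; exact: Af.
have [l [Al cl]] := cA (f @ U) _ fA.
exists l => // V lV; have [//|nV] := in_ultra_setVsetC (f @^-1` V) UU.
by have [z [+ Vz]] := cl (~` V) V nV lV; move=> /(_ Vz).
Qed.

(** The inner limit of [S] with 'eventually' read as '[U]-almost surely'.
    When [U] is an ultrafilter the outer limit defined in the same way is the
    same set. *)
Definition ulim (I : Type) (U : set_system I) (T : topologicalType)
    (S : I -> set T) : set T :=
  [set z | forall V, nbhs z V -> U [set i | S i `&` V !=set0]].

Lemma ulim_cvg (I : Type) (U : set_system I) (T : topologicalType)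
    (S : I -> set T) (f : I -> T) (l : T) :
  Filter U -> (forall i, S i (f i)) -> f @ U --> l -> ulim U S l.
Proof.
move=> FU Sf fl V /fl /= UV.
apply: filterS (UV : U (f @^-1` V)) => i Vfi.
by exists (f i); split; [exact: Sf|exact: Vfi].
Qed.

Lemma ulim_sub_closed (I : Type) (U : set_system I) (T : topologicalType)
    (S : I -> set T) (A : set T) :
  ProperFilter U -> closed A -> (forall i, S i `<=` A) -> ulim U S `<=` A.
Proof.
move=> FU cA SA z Uz; apply: cA => V /Uz /filter_ex [i [w [Sw Vw]]].
by exists w; split=> //; exact: SA Sw.
Qed.

(** For each basic open set [W] the indices at which [S] meets [W], or those at
    which it does not, have full [U]-measure.  Finitely many of these countably
    many verdicts can be respected by one index; letting [s n] respect the
    first [n + 1] of them, each verdict holds along [s] from some rank on.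
    Nothing forces [s] to tend to infinity. *)
Lemma PK_converges_ulim (I : Type) (U : set_system I) (T : topologicalType)
    (S : I -> set T) :
  UltraFilter U -> @second_countable T ->
  exists s : nat -> I, PK_converges (fun n => S (s n)) (ulim U S).
Proof.
move=> UU [B /countable_injP [code code_inj] [Bopen Bbase]].
have base z V : nbhs z V -> exists W, [/\ B W, W z & W `<=` V].
  by move=> /Bbase [W [BW Wz] WV]; exists W.
pose hits W := [set i | S i `&` W !=set0].
(* [decided W] : the indices that agree with the [U]-verdict on [W]. *)
pose decided W := [set i | hits W i <-> U (hits W)].
have Udecided W : U (decided W).
  have [UW|UW] := in_ultra_setVsetC (hits W) UU; apply: filterS (UW) => i iW.
    by split.
  split=> // UhW; have /filter_ex [k [k1 k2]] : U (hits W `&` ~` hits W).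
    exact: filterI.
  by have := k2 k1.
have Ucode k : U [set i | forall W, B W -> code W = k -> decided W i].
  have [[W [BW kW]]|nW] := pselect (exists W, B W /\ code W = k); last first.
    by apply: filterS filterT => i _ W BW kW; case: nW; exists W.
  apply: filterS (Udecided W) => i iW W' BW' kW'.
  suff -> : W' = W by [].
  by apply: code_inj; rewrite ?inE // kW'.
have Uinit l :
    U [set i | forall W, B W -> (code W < l)%N -> decided W i].
  elim: l => [|l IH]; first by apply: filterS filterT.
  apply: filterS (filterI IH (Ucode l)) => i [iIH il] W BW.
  by rewrite ltnS leq_eqVlt => /orP[/eqP|]; [exact: il|exact: iIH].
have [s sP] := choice (fun l => filter_ex (Uinit l.+1)).
have sdec W n : B W -> (code W <= n)%N -> decided W (s n).
  by move=> BW cn; apply: sP => //=.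
have inner_outer C : @inner_limit T C `<=` outer_limit C.
  move=> z zC V /zC [N _ NC] M; exists (maxn N M); first exact: leq_maxr.
  by apply: NC; exact: leq_maxl.
have ulim_inner : ulim U S `<=` inner_limit (fun n => S (s n)).
  move=> z Uz V /base [W [BW Wz WV]].
  have UW : U (hits W) by apply: Uz; apply: open_nbhs_nbhs; split=> //; exact: Bopen.
  exists (code W) => // n /= Wn; have /(_ UW) [w [Sw Ww]] := (sdec W n BW Wn).2.
  by exists w; split=> //; exact: WV.
have outer_ulim : outer_limit (fun n => S (s n)) `<=` ulim U S.
  move=> z oz V /base [W [BW Wz WV]].
  have zW : nbhs z W by apply: open_nbhs_nbhs; split=> //; exact: Bopen.
  have [n Wn hW] := oz _ zW (code W).
  apply: filterS ((sdec W n BW Wn).1 hW) => i [w [Sw Ww]].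
  by exists w; split=> //; exact: WV.
exists s; split; rewrite eqEsubset; split=> //.
- exact: subset_trans (inner_outer _) outer_ulim.
- exact: subset_trans ulim_inner (inner_outer _).
Qed.

Lemma dense_second_countable (R : realType) (T : pseudoMetricType R)
    (C : countType) (D : C -> T) :
  (forall z (e : R), 0 < e -> exists c, ball z e (D c)) -> @second_countable T.
Proof.
move=> Ddense.
pose B (ck : C * nat) := (ball (D ck.1) ((ck.2.+1%:R : R)^-1))^°.
exists (range B).
  exact: sub_countable (card_image_le _ _) (countableP _).
split=> [_ [ck _ <-]|z V]; first exact: open_interior.
move=> /nbhs_ballP [e /= e0 zeV].
have e20 : 0 < e / 2 by rewrite divr_gt0.
have [k _ /(_ k (leqnn _))] := near_infty_natSinv_lt (PosNum e20).
move=> /= ke; set r := (k.+1%:R : R)^-1 in ke.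
have r0 : 0 < r by rewrite invr_gt0 ltr0n.
have r20 : 0 < r / 2 by rewrite divr_gt0.
have [c zc] := Ddense z _ r20.
exists (B (c, k)); first split.
- by exists (c, k).
- rewrite /B /= /interior -/r; apply/nbhs_ballP; exists (r / 2) => //= y zy.
  by rewrite (splitr r); apply: ball_triangle zy; exact: ball_sym.
- move=> y /interior_subset; rewrite -/r => cy; apply: zeV.
  rewrite (splitr e); apply: (@ball_triangle _ _ (D c)).
    by apply: le_ball zc; apply: ltW; apply: le_lt_trans ke;
      rewrite ler_pdivrMr// ler_peMr ?ltW// ltr1n.
  by apply: le_ball cy; exact: ltW.
Qed.

Lemma rational_dense (R : realType) (x e : R) : 0 < e -> exists q : rat, ball x e (ratr q).
Proof.
move=> e0; have [|q] := @rat_in_itvoo R (x - e) (x + e).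
  by rewrite ltrBlDr -addrA ltrDl addr_gt0.
by exists q; rewrite ball_itv.
Qed.

Lemma graph_space_second_countable (R : realType) (d : nat) :
  @second_countable (R * R * 'rV[R]_d)%type.
Proof.
pose D (c : rat * rat * 'rV[rat]_d) : R * R * 'rV[R]_d :=
  (ratr c.1.1, ratr c.1.2, map_mx ratr c.2).
apply: (@dense_second_countable R _ _ D).
move=> [[t j] x] e e0 /=.
have [q1 tq] := @rational_dense R t e e0; have [q2 jq] := @rational_dense R j e e0.
have [q xq] := choice (fun i => @rational_dense R (x 0 i) e e0).
exists (q1, q2, \row_i q i); split; first by split.
split=> // i k; rewrite !mxE ord1; exact: xq.
Qed.

(** * Hybrid time domains *)

Section HybridTime.
Context (R : realType) (E : set (R * nat)).
Hypothesis htdE : hybrid_time_domain E.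

(** Two points of a hybrid time domain lie in one of the compact domains that
    exhaust it, so that both can be described by the same switching times. *)
Lemma hybrid_time_domain_cover (p q : R * nat) : E p -> E q ->
  exists (t : nat -> R) (J : nat),
    [/\ t 0%N = 0, forall i j, (i <= j <= J)%N -> t i <= t j,
        forall s i, (i < J)%N -> t i <= s <= t i.+1 -> E (s, i),
        (p.2 < J)%N /\ t p.2 <= p.1 <= t p.2.+1 &
        (q.2 < J)%N /\ t q.2 <= q.1 <= t q.2.+1].
Proof.
have [F [Fc Fmono ->]] := htdE => -[m _ Fp] [n _ Fq].
have Fle k l : (k <= l)%N -> F k `<=` F l.
  elim: l => [|l IH]; first by rewrite leqn0 => /eqP ->.
  rewrite leq_eqVlt => /orP[/eqP -> //|]; rewrite ltnS => /IH kl.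
  exact: subset_trans kl (Fmono l).
have {}Fp := Fle _ _ (leq_maxl m n) p Fp.
have {}Fq := Fle _ _ (leq_maxr m n) q Fq.
have [J [t [J0 t0 tmono FE]]] := Fc (maxn m n).
have inF s i : F (maxn m n) (s, i) <-> (i < J)%N /\ t i <= s <= t i.+1.
  rewrite FE; split=> [[k /= kJ []]|[iJ si]].
    by rewrite /= in_itv /= => sk ->.
  by exists i => //; split=> //=; rewrite in_itv.
exists t, J; split=> //.
- move=> i; elim=> [|j IH] /andP[]; first by rewrite leqn0 => /eqP ->.
  rewrite leq_eqVlt => /orP[/eqP -> //|]; rewrite ltnS => ij jJ.
  by apply: le_trans (tmono _ jJ); apply: IH; rewrite ij ltnW.
- by move=> s i iJ si; exists (maxn m n) => //; apply/inF.
- by apply/inF; rewrite -surjective_pairing.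
- by apply/inF; rewrite -surjective_pairing.
Qed.

Lemma hybrid_time_ge0 t j : E (t, j) -> 0 <= t.
Proof.
move=> tj; have [u [J [u0 umono _ [/= jJ /andP[jt _]] _]]] :=
  hybrid_time_domain_cover tj tj.
by apply: le_trans jt; rewrite -u0; apply: umono => /=; exact: ltnW.
Qed.

(** The points of a hybrid time domain are ordered by [t + j]: time does not
    decrease from one interval to the next. *)
Lemma hybrid_time_le s i t j : E (s, i) -> E (t, j) ->
  s + i%:R <= t + j%:R -> s <= t /\ (i <= j)%N.
Proof.
move=> si tj.
have [u [J [u0 umono _ [/= iJ /andP[is1 is2]] [/= jJ /andP[jt1 jt2]]]]] :=
  hybrid_time_domain_cover si tj.
case: (ltngtP i j) => [ij|ji|->]; last by rewrite lerD2r.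
- by move=> _; split=> //; apply: le_trans is2 (le_trans _ jt1); apply: umono; rewrite ij ltnW.
- rewrite leNgt => /negP[]; apply: ler_ltD; last by rewrite ltr_nat.
  by apply: le_trans jt2 (le_trans _ is1); apply: umono; rewrite ji ltnW.
Qed.

(** Along a hybrid time domain [t + j] is continuous up to jumps of height one,
    so it comes within one of every intermediate value.  The witness is the
    first moment of the first interval on which [t + j] reaches [c]. *)
Lemma hybrid_time_between t j c : E (t, j) -> 0 <= c <= t + j%:R ->
  exists s i, E (s, i) /\ c <= s + i%:R <= c + 1 /\ s + i%:R <= t + j%:R.
Proof.
move=> tj /andP[c0 ctj].
have [u [J [u0 umono uE [/= jJ /andP[jt1 jt2]] _]]] :=
  hybrid_time_domain_cover tj tj.
have [|i ci imin] := @ex_minnP (fun i => c <= u i.+1 + i%:R).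
  by exists j; apply: le_trans ctj _; rewrite lerD2r.
have ij : (i <= j)%N by apply: imin; apply: le_trans ctj _; rewrite lerD2r.
have iJ : (i < J)%N by exact: leq_ltn_trans jJ.
have uiSi : u i <= u i.+1 by apply: umono; rewrite leqnSn.
exists (Num.max (u i) (c - i%:R)), i; split; last split.
- by apply: uE => //; rewrite le_max lexx /= ge_max uiSi /= lerBlDr.
- rewrite -lerBlDr le_max lexx orbT /= -lerBrDr ge_max !lerBrDr subrK lerDl ler01 andbT.
  case: i imin {ci ij uiSi} iJ => [|k] kmin kJ; first by rewrite u0 addr0 addr_ge0.
  rewrite -natr1 addrA lerD2r leNgt; apply/negP => /ltW /kmin.
  by rewrite ltnn.
- rewrite -lerBrDr ge_max lerBrDr lerB // andbT.
  by rewrite lerD // ?ler_nat // (le_trans _ jt1) //; apply: umono; rewrite ij ltnW.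
Qed.

End HybridTime.

(** * Arcs, steps and chains *)

(** [I] prescribes the length [t + j]: a bounded closed interval makes arcs
    compact, the ray from [tau] gives the pieces of chains. *)
Definition arc (R : realType) (d : nat) (M : set (hcurve R d))
    (K : set 'rV[R]_d) (I : set R) (a e : 'rV[R]_d) :=
  exists phi t j, [/\ M phi, phi 0 0%N = Some a, phi t j = Some e,
    I (t + j%:R) &
    forall s i z, phi s i = Some z -> s + i%:R <= t + j%:R -> K z].

(** Jumps are measured with the sup norm, so that the metric estimates can use
    the normed space structure of row vectors; the Euclidean balls come back
    only in the translation from and to finite chains. *)
Definition step (R : realType) (d : nat) (M : set (hcurve R d))
    (K : set 'rV[R]_d) (I : set R) (delta : R) (a b : 'rV[R]_d) :=
  exists2 e, arc M K I a e & `|e - b| <= delta.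

Definition chain (R : realType) (d : nat) (M : set (hcurve R d))
    (K : set 'rV[R]_d) (I : set R) (delta : R) :=
  clos_trans 'rV[R]_d (step M K I delta).

Section Chains.
Context (R : realType) (d : nat).
Implicit Types (M : set (hcurve R d)) (K : set 'rV[R]_d) (I : set R).

Lemma arcS M K K' I I' a e :
  K `<=` K' -> I `<=` I' -> arc M K I a e -> arc M K' I' a e.
Proof.
move=> KK' II' [phi [t [j [Mphi phi0 phie Itj Kphi]]]].
exists phi, t, j; split=> //; first exact: II'.
by move=> s i z phis st; apply: KK'; exact: Kphi phis st.
Qed.

Lemma chainS M K K' I I' delta delta' a b :
  K `<=` K' -> I `<=` I' -> delta <= delta' ->
  chain M K I delta a b -> chain M K' I' delta' a b.
Proof.
move=> KK' II' dd'; elim=> [u v [e ue ev]|u v w _ uv _ vw].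
  by apply: t_step; exists e; [exact: arcS ue|exact: le_trans dd'].
exact: t_trans uv vw.
Qed.

Lemma step_shift M K I delta eta a b b' :
  step M K I delta a b -> `|b - b'| <= eta -> step M K I (delta + eta) a b'.
Proof.
move=> [e ae eb] bb'; exists e => //.
by rewrite -(subrKA b); apply: le_trans (ler_normD _ _) _; exact: lerD.
Qed.

Lemma chain_shift M K I delta eta a b b' :
  0 <= eta ->
  chain M K I delta a b -> `|b - b'| <= eta -> chain M K I (delta + eta) a b'.
Proof.
move=> eta0 /clos_trans_tn1_iff ab bb'.
have mono u v : chain M K I delta u v -> chain M K I (delta + eta) u v.
  by apply: chainS => //; rewrite lerDl.
case: ab bb' => [c ac|c c' cc' /clos_trans_tn1_iff ac] bb'.
  exact/t_step/(step_shift ac).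
exact: t_trans (mono _ _ ac) (t_step _ _ _ _ (step_shift cc' bb')).
Qed.

Lemma tail_arc M K I phi s i t j y e : tail_invariant M ->
  M phi -> hybrid_time_domain (hdom phi) ->
  phi s i = Some y -> phi t j = Some e -> s + i%:R <= t + j%:R ->
  (forall s' i' z, phi s' i' = Some z -> s' + i'%:R <= t + j%:R -> K z) ->
  I (t + j%:R - (s + i%:R)) -> arc M K I y e.
Proof.
move=> Mtail Mphi hphi phis phit st Kphi Ist.
have dom u k z : phi u k = Some z -> hdom phi (u, k) by rewrite /hdom /= => ->.
have [{}st ij] := hybrid_time_le hphi (dom _ _ _ phis) (dom _ _ _ phit) st.
exists (tail phi s i), (t - s), (j - i)%N; split.
- exact: Mtail (dom _ _ _ phis).
- by rewrite /tail lexx addr0 addn0.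
- by rewrite /tail subr_ge0 st addrC subrK subnKC.
- by rewrite natrB // addrACA -opprD.
- move=> s' i' z; rewrite /tail; case: ifP => // _ /Kphi Kz le_s'.
  apply: Kz; rewrite natrD addrACA -lerBrDl opprD.
  by rewrite addrACA -natrB.
Qed.

Lemma arc_refl M K I phi a : M phi -> hybrid_time_domain (hdom phi) ->
  phi 0 0%N = Some a -> K a -> I 0 -> arc M K I a a.
Proof.
move=> Mphi hphi phi0 Ka I0; exists phi, 0, 0%N; split=> //.
  by rewrite addr0.
move=> s i z phis s0.
have [||s_le0] := hybrid_time_le hphi (s := s) (i := i) (t := 0) (j := 0%N) _ _ s0.
- by rewrite /hdom /= phis.
- by rewrite /hdom /= phi0.
rewrite leqn0 => /eqP i0.
have s_ge0 : 0 <= s by apply: (hybrid_time_ge0 hphi (j := i)); rewrite /hdom /= phis.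
have s00 : s = 0 by apply/eqP; rewrite eq_le s_le0 s_ge0.
by move: phis; rewrite i0 s00 phi0 => -[<-].
Qed.

Lemma arc_cat M K I J (I' : set R) a c e :
  closed_under_concatenation M ->
  (forall phi, M phi -> hybrid_time_domain (hdom phi)) ->
  (forall l l', I l -> J l' -> I' (l + l')) ->
  arc M K I a c -> arc M K J c e -> arc M K I' a e.
Proof.
move=> Mcat Mdom IJ [phi [s [i [Mphi phi0 phis Is Kphi]]]].
move=> [psi [t [j [Mpsi psi0 psit Jt Kpsi]]]].
have dom (f : hcurve R d) u k z : f u k = Some z -> hdom f (u, k) by rewrite /hdom /= => ->.
have s0 := hybrid_time_ge0 (Mdom _ Mphi) (dom _ _ _ _ phis).
have t0 := hybrid_time_ge0 (Mdom _ Mpsi) (dom _ _ _ _ psit).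
exists (concatenation phi psi s i), (s + t), (i + j)%N; split.
- by apply: Mcat; rewrite ?phis ?psi0 //; exact: dom phis.
- by rewrite /concatenation addr0 addr_ge0.
- rewrite /concatenation natrD addrACA gerDl leq_addr addKn (addrC s) addrK.
  case: ifP => // tj0.
  have /andP[/eqP t00] : (t == 0) && (j%:R == 0 :> R).
    by rewrite -paddr_eq0 // eq_le tj0 addr_ge0.
  rewrite pnatr_eq0 => /eqP j0; move: psit.
  by rewrite t00 j0 add0r addn0 psi0 phis.
- by rewrite natrD addrACA; exact: IJ.
- move=> u k z; rewrite /concatenation natrD addrACA.
  case: ifP => [us phiu _|_]; first exact: Kphi phiu us.
  case: ifP => // ik /Kpsi Kz le_u; apply: Kz.
  by rewrite natrB // addrACA -opprD lerBlDl.
Qed.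

(** The arc is cut where its length first reaches [c], up to the overshoot of
    one that a jump can cause. *)
Lemma arc_split M K c l1 l2 a e : tail_invariant M ->
  (forall phi, M phi -> hybrid_time_domain (hdom phi)) -> 0 <= c <= l1 ->
  arc M K `[l1, l2] a e ->
  exists2 m, arc M K `[c, c + 1] a m & arc M K `[l1 - (c + 1), l2 - c] m e.
Proof.
move=> Mtail Mdom /andP[c0 cl1] [phi [t [j [Mphi phi0 phit]]]].
rewrite /= in_itv /= => /andP[l1t tl2] Kphi.
have [||s [i [si [/andP[cs sc] st]]]] :=
  hybrid_time_between (Mdom _ Mphi) (t := t) (j := j) (c := c).
- by rewrite /hdom /= phit.
- by rewrite c0 (le_trans cl1).
case phis : (phi s i) si => [m|]; last by rewrite /hdom /= phis.
move=> _; exists m.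
  exists phi, s, i; split=> //; first by rewrite /= in_itv /= cs.
  by move=> s' i' z /Kphi Kz le_s'; apply: Kz; exact: le_trans st.
apply: (tail_arc Mtail Mphi (Mdom _ Mphi) phis phit st Kphi).
by rewrite /= in_itv /= !lerB.
Qed.

(** As long as a piece is longer than [2 tau + 1], an initial part of length in
    [[tau, tau + 1]] is cut off; what is left still has length at least [tau],
    and the cut causes no jump. *)
Lemma chain_chop M K tau delta a b : tail_invariant M ->
  (forall phi, M phi -> hybrid_time_domain (hdom phi)) ->
  0 < tau -> 0 <= delta ->
  chain M K `[tau, +oo[ delta a b -> chain M K `[tau, 2 * tau + 1] delta a b.
Proof.
move=> Mtail Mdom tau0 delta0.
have chop n u e v : arc M K `[tau, 2 * tau + 1 + n%:R * tau] u e ->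
    `|e - v| <= delta -> chain M K `[tau, 2 * tau + 1] delta u v.
  elim: n u => [|n IH] u ue ev.
    by apply: t_step; exists e => //; move: ue; rewrite mul0r addr0.
  have [phi [t [j [Mphi phi0 phit + Kphi]]]] := ue.
  rewrite /= in_itv /= => /andP[taut tt].
  have [t_le|/ltW t_ge] := leP (t + j%:R) (2 * tau + 1).
    apply: t_step; exists e => //; exists phi, t, j; split=> //.
    by rewrite /= in_itv /= taut.
  have ue' : arc M K `[2 * tau + 1, 2 * tau + 1 + n.+1%:R * tau] u e.
    by exists phi, t, j; split=> //; rewrite /= in_itv /= t_ge.
  have [|m um me] := arc_split (c := tau) Mtail Mdom _ ue'.
    by rewrite ltW //=; lra.
  apply: (@t_trans _ _ _ m).
    apply: t_step; exists m; last by rewrite subrr normr0.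
    by apply: arcS um => // l; rewrite /= !in_itv /= => /andP[-> /=]; lra.
  apply: IH ev; apply: arcS me => // l.
  by rewrite /= !in_itv /= -natr1; nra.
elim=> [u v [e [phi [t [j [Mphi phi0 phit + Kphi]]]] ev]|u v w _ + _].
  rewrite /= in_itv /= andbT => taut.
  pose n := Num.bound ((t + j%:R) / tau).
  apply: (chop n _ e) ev; exists phi, t, j; split=> //; rewrite /= in_itv /= taut /=.
  have : (t + j%:R) / tau < n%:R.
    by apply: archi_boundP; rewrite divr_ge0 ?ltW// (lt_le_trans tau0).
  by rewrite ltr_pdivrMr// => /ltW; lra.
exact: t_trans.
Qed.

End Chains.

(** * The Euclidean norm and the sup norm *)

Lemma norm_le_enorm (R : realType) (d : nat) (x : 'rV[R]_d) : `|x| <= enorm x.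
Proof.
have [->|/mx_norm_neq0 [[i k] /= xE]] := eqVneq `|x| 0; first exact: sqrtr_ge0.
rewrite [leLHS]xE.
rewrite ord1 -sqrtr_sqr ler_sqrt; last by apply: sumr_ge0 => l _; exact: sqr_ge0.
by rewrite (bigD1 k) //= lerDl; apply: sumr_ge0 => l _; exact: sqr_ge0.
Qed.

Lemma enorm_le_norm (R : realType) (d : nat) (x : 'rV[R]_d) :
  enorm x <= d.+1%:R * `|x|.
Proof.
have coord k : `|x 0 k| <= `|x|.
  by rewrite [leRHS]mx_normrE; apply: (le_bigmax _ _ (0, k)).
have d0 : 0 <= d.+1%:R * `|x| by rewrite mulr_ge0.
rewrite -[leRHS]ger0_norm// -sqrtr_sqr ler_sqrt ?sqr_ge0//.
apply: (@le_trans _ _ (\sum_(i < d) `|x| ^+ 2)).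
  apply: ler_sum => k _; rewrite -real_normK ?num_real//.
  by rewrite ler_pXn2r ?nnegrE.
rewrite sumr_const card_ord exprMn -[leLHS]mulr_natl ler_wpM2r ?sqr_ge0//.
by rewrite -natrX ler_nat; exact: leq_trans (leqnSn d) (leq_pmull _ _).
Qed.

Section Limits.
Context (R : realType) (d : nat) (L : set (hcurve R d)) (X : set 'rV[R]_d).
Hypothesis curvesL : forall phi, L phi -> hybrid_curve phi.
Hypothesis wellposedL : nominally_well_posed L.
Hypothesis compactX : compact X.
Let M := restrict_to L X.

Lemma restrict_hybrid_time phi : M phi -> hybrid_time_domain (hdom phi).
Proof. by move=> [/curvesL []]. Qed.

Lemma restrict_locally_eventually_bounded (phi : nat -> hcurve R d) :
  (forall n, M (phi n)) -> locally_eventually_bounded phi.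
Proof.
move=> Mphi T T0; have [B [B0 XB]] := ex_strict_bound_gt0 (compact_bounded compactX).
exists 0%N, (d.+1%:R * B); split; first exact: mulr_gt0.
move=> n _ t j x phix _; rewrite /eball /= subr0.
apply: le_trans (enorm_le_norm _) _; rewrite ler_wpM2l// ltW// XB//.
exact: (Mphi n).2 phix.
Qed.

(** The compactness of bounded arcs.  The inclusion in [ulim U K] deserves a
    word: a point of the limit curve strictly before its end is a limit of
    points of the graphs that come strictly before the ends, because the
    lengths converge; and two points of a hybrid time domain with the same
    [t + j] are equal, so the only other point is the end itself. *)
Lemma arc_ulim (T : Type) (U : set_system T) (K : T -> set 'rV[R]_d)
    (I : set R) (B : R) (a e : T -> 'rV[R]_d) :
  UltraFilter U -> closed I -> (forall l, I l -> l <= B) ->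
  (forall n, arc M (K n) I (a n) (e n)) ->
  exists a' e', [/\ a @ U --> a', e @ U --> e' & arc M (ulim U K) I a' e'].
Proof.
move=> UU Iclosed IB arcs.
have Xclosed : closed X by apply: compact_closed compactX; exact: norm_hausdorff.
have dom (f : hcurve R d) u k z : f u k = Some z -> hdom f (u, k).
  by rewrite /hdom /= => ->.
have [phi /choice [t /choice [j arcP]]] := choice arcs.
have Mphi n : M (phi n) by have [] := arcP n.
have phi0 n : phi n 0 0%N = Some (a n) by have [] := arcP n.
have phit n : phi n (t n) (j n) = Some (e n) by have [] := arcP n.
have It n : I (t n + (j n)%:R) by have [] := arcP n.
have Kphi n s i z : phi n s i = Some z -> s + i%:R <= t n + (j n)%:R -> K n z.
  by have [_ _ _ _] := arcP n; exact.
have t_ge0 n : 0 <= t n.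
  exact (hybrid_time_ge0 (restrict_hybrid_time (Mphi n)) (dom _ _ _ _ (phit n))).
have tB n : `[0, B]%classic (t n).
  by rewrite /= in_itv /= t_ge0 (le_trans _ (IB _ (It n))) // lerDl.
have jB n : `[0, B]%classic ((j n)%:R : R).
  by rewrite /= in_itv /= ler0n (le_trans _ (IB _ (It n))) // lerDr.
have [t' _ tcvg] := compact_ultra_cvg UU (@segment_compact R 0 B) tB.
have [r _ jcvg] := compact_ultra_cvg UU (@segment_compact R 0 B) jB.
have [a' _ acvg] := compact_ultra_cvg UU compactX (fun n => (Mphi n).2 _ _ _ (phi0 n)).
have [e' _ ecvg] := compact_ultra_cvg UU compactX (fun n => (Mphi n).2 _ _ _ (phit n)).
exists a', e'; split=> //.
have [s sPK] := PK_converges_ulim (fun n => gph (phi n)) UU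
  (@graph_space_second_countable R d).
have [psi Lpsi psiG] := wellposedL.1 (fun n => phi (s n)) _ (fun n => (Mphi (s n)).1)
  (restrict_locally_eventually_bounded (fun n => Mphi (s n))) sPK.
have psiP u k z : ulim U (fun n => gph (phi n)) (u, k%:R, z) -> psi u k = Some z.
  by rewrite -psiG => -[u' [k' [z' [psiz [-> /eqP + ->]]]]]; rewrite eqr_nat => /eqP ->.
have Gpsi u k z : psi u k = Some z -> ulim U (fun n => gph (phi n)) (u, k%:R, z).
  by rewrite -psiG => ?; exists u, k, z.
have Mpsi : M psi.
  split=> // u k z /Gpsi Gz.
  suff: ulim U (fun=> X) z by apply: ulim_sub_closed => // _.
  move=> V zV.
  have /Gz : nbhs ((u, k%:R, z) : R * R * 'rV[R]_d) [set q | V q.2].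
    exact: cvg_snd zV.
  apply: filterS => n [_ [[u' [k' [z' [phiz ->]]]] Vz]].
  by exists z'; split=> //; exact: (Mphi n).2 phiz.
have Gend : ulim U (fun n => gph (phi n)) (t', r, e').
  apply: (@ulim_cvg _ U _ _ (fun n => (t n, (j n)%:R, e n) : R * R * 'rV[R]_d)) => [n|].
    by exists (t n), (j n), (e n).
  exact: cvg_pair (cvg_pair tcvg jcvg) ecvg.
(* The limit [r] of the discrete times is an integer since the limit of the
   graphs is a graph. *)
have [k rk] : exists k : nat, r = k%:R.
  by move: Gend; rewrite -psiG => -[u [k [z [_ [_ -> _]]]]]; exists k.
have psit : psi t' k = Some e' by apply: psiP; rewrite -rk.
have psi0 : psi 0 0%N = Some a'.
  apply: psiP; apply: (@ulim_cvg _ U _ _ (fun n => (0, 0%:R, a n) : R * R * 'rV[R]_d)) => [n|].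
    by exists 0, 0%N, (a n).
  exact: cvg_pair (cvg_cst _) acvg.
(* Convergence of the lengths gives membership in the closed set [I], and it
   separates the earlier points of the limit curve from the end. *)
have lcvg : (fun n => t n + (j n)%:R) @ U --> t' + k%:R.
  by rewrite -rk; exact: cvgD.
exists psi, t', k; split=> //.
  by apply: closed_cvg lcvg => //; apply: filterS filterT => n _.
move=> u i z psiz ui_le.
have [ui_eq|ui_ne] := eqVneq (u + i%:R) (t' + k%:R).
  have hpsi := restrict_hybrid_time Mpsi.
  have [ut ik] := hybrid_time_le hpsi (dom _ _ _ _ psiz) (dom _ _ _ _ psit) ui_le.
  have [] := hybrid_time_le hpsi (dom _ _ _ _ psit) (dom _ _ _ _ psiz).
    by rewrite ui_eq.
  move=> tu ki; have uE : u = t' by apply/eqP; rewrite eq_le ut tu.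
  have iE : i = k by apply/eqP; rewrite eqn_leq ik ki.
  move: psiz; rewrite uE iE psit => -[<-].
  by apply: ulim_cvg ecvg => n; exact: Kphi (phit n) _.
have {ui_ne}ui_lt : u + i%:R < t' + k%:R by rewrite lt_neqAle ui_ne.
pose c := ((u + i%:R) + (t' + k%:R)) / 2.
have [c1 c2] : u + i%:R < c /\ c < t' + k%:R by rewrite /c; split; lra.
have cU : U [set n | c < t n + (j n)%:R].
  exact: (lcvg [set l | c < l] (lt_nbhsr c2)).
move=> V zV.
have uiz : nbhs ((u, i%:R, z) : R * R * 'rV[R]_d) [set q | q.1.1 + q.1.2 < c /\ V q.2].
  apply: filterI; last exact: cvg_snd zV.
  have : (fun q : R * R * 'rV[R]_d => q.1.1 + q.1.2) q
      @[q --> ((u, i%:R, z) : R * R * 'rV[R]_d)] --> u + i%:R.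
    apply: cvgD; (apply: cvg_comp; first exact: cvg_fst).
      exact: cvg_fst.
    exact: cvg_snd.
  by move=> /(_ [set l | l < c]); apply; exact: lt_nbhsl.
apply: filterS (filterI cU (Gpsi _ _ _ psiz _ uiz)) => n [/= cn].
move=> [_ [[u' [i' [z' [phiz ->]]]] [/= uc Vz]]].
exists z'; split=> //; apply: Kphi phiz _.
exact/ltW/(lt_trans uc).
Qed.

End Limits.

(** * Chain recurrence *)

Lemma free_ultra_cvg (R : realType) (V : normedModType R) (U : set_system nat)
    (f : nat -> V) (y : V) (c : R) :
  Filter U -> \oo `<=` U -> 0 < c ->
  (forall n, `|f n - y| <= c / n.+1%:R) -> f @ U --> y.
Proof.
move=> UU Uinf c0 fy; apply/cvgrPdistC_le => e e0.
apply: Uinf; have ce : 0 < e / c by rewrite divr_gt0.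
have := near_infty_natSinv_lt (PosNum ce); apply: filterS => n /= /ltW ne.
by apply: le_trans (fy n) _; rewrite mulrC -ler_pdivlMr.
Qed.

(** Both chains are required to be nonempty; a cycle that consists of a single
    piece qualifies by going round it again. *)
Definition on_cycle (R : realType) (d : nat) (M : set (hcurve R d))
    (I : set R) (delta : R) : set 'rV[R]_d :=
  [set y | exists a e b,
     [/\ arc M setT `[0, +oo[ a y, arc M setT `[0, +oo[ y e, `|e - b| <= delta,
         chain M setT I delta a b & chain M setT I delta b a]].

Lemma on_cycleS (R : realType) (d : nat) (M : set (hcurve R d))
    (I I' : set R) (delta delta' : R) :
  I `<=` I' -> delta <= delta' ->
  on_cycle M I delta `<=` on_cycle M I' delta'.
Proof.
move=> II' dd' y [a [e [b [ay ye eb ab ba]]]]; exists a, e, b; split=> //.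
- exact: le_trans dd'.
- exact: chainS ab.
- exact: chainS ba.
Qed.

(** The chain is cut at its junctions by induction; the return chain of each
    part goes round through the other part, which is why the statement is about
    two chains rather than one cycle. *)
Lemma cycle_arcs_on_cycle (R : realType) (d : nat) (M : set (hcurve R d))
    (I : set R) (delta : R) (a b : 'rV[R]_d) :
  tail_invariant M -> (forall phi, M phi -> hybrid_time_domain (hdom phi)) ->
  chain M setT I delta a b -> chain M setT I delta b a ->
  chain M (on_cycle M I delta) I delta a b.
Proof.
move=> Mtail Mdom; elim=> {a b} [a b [e ae eb] ba|a c b ac IHac cb IHcb ba].
  apply: t_step; exists e => //.
  have [phi [t [j [Mphi phi0 phit It _]]]] := ae.
  exists phi, t, j; split=> // s i z phis st; exists a, e, b; split=> //.
  - exists phi, s, i; split=> //; rewrite /= in_itv /= andbT addr_ge0//.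
    by apply: (hybrid_time_ge0 (Mdom _ Mphi) (j := i)); rewrite /hdom /= phis.
  - by apply: (tail_arc Mtail Mphi (Mdom _ Mphi) phis phit st) => //=;
      rewrite in_itv /= andbT subr_ge0.
  - by apply: t_step; exists e.
apply: t_trans (IHac _) (IHcb _); first exact: t_trans ba.
exact: t_trans ac.
Qed.

Section Recurrence.
Context (R : realType) (d : nat) (L : set (hcurve R d)) (X : set 'rV[R]_d).
Hypothesis curvesL : forall phi, L phi -> hybrid_curve phi.
Hypothesis wellposedL : nominally_well_posed L.
Hypothesis tailL : tail_invariant L.
Hypothesis concatL : closed_under_concatenation L.
Hypothesis compactX : compact X.
Let M := restrict_to L X.
Let Mdom phi : M phi -> hybrid_time_domain (hdom phi).
Proof. exact: restrict_hybrid_time. Qed.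

Lemma restrict_tail_invariant : tail_invariant M.
Proof.
move=> phi s i [Lphi Xphi] si; split; first exact: tailL.
by move=> t j z; rewrite /tail; case: ifP => // _ /Xphi.
Qed.

Lemma restrict_closed_under_concatenation : closed_under_concatenation M.
Proof.
move=> phi psi s i [Lphi Xphi] [Lpsi Xpsi] si e; split; first exact: concatL.
move=> t j z; rewrite /concatenation; case: ifP => [_ /Xphi //|_].
by case: ifP => // _ /Xpsi.
Qed.

Lemma arc_cases K I tau a e : arc M K I a e ->
  arc M K `[0, tau] a e \/ arc M K `[tau, +oo[ a e.
Proof.
move=> [phi [t [j [Mphi phi0 phit _ Kphi]]]].
have t0 : 0 <= t by apply: (hybrid_time_ge0 (Mdom Mphi) (j := j)); rewrite /hdom /= phit.
have [tj|/ltW tj] := leP (t + j%:R) tau; [left|right].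
  by exists phi, t, j; split=> //; rewrite /= in_itv /= tj andbT addr_ge0.
by exists phi, t, j; split=> //; rewrite /= in_itv /= tj.
Qed.

(** Where almost matching arcs become one: the mismatch between the end of the
    first and the start of the second vanishes in the limit, and only there
    closure under concatenation can be used. *)
Lemma arc_ulim_cat (T : Type) (U : set_system T) (I J I' : set R) (B : R)
    (a p b e : T -> 'rV[R]_d) :
  UltraFilter U -> closed I -> closed J ->
  (forall l, I l -> l <= B) -> (forall l, J l -> l <= B) ->
  (forall l l', I l -> J l' -> I' (l + l')) ->
  (forall n, arc M setT I (a n) (p n)) -> (forall n, arc M setT J (b n) (e n)) ->
  (fun n => p n - b n) @ U --> (0 : 'rV[R]_d) ->
  exists a' e', [/\ a @ U --> a', e @ U --> e' & arc M setT I' a' e'].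
Proof.
move=> UU cI cJ IB JB IJ ap be pb.
have [a' [p' [acvg pcvg ap']]] := arc_ulim curvesL wellposedL compactX UU cI IB ap.
have [b' [e' [bcvg ecvg be']]] := arc_ulim curvesL wellposedL compactX UU cJ JB be.
have pb' : p' = b'.
  apply/eqP; rewrite -subr_eq0; apply/eqP.
  by apply: (cvg_unique _ (cvgB pcvg bcvg) pb); exact: norm_hausdorff.
exists a', e'; split=> //; rewrite pb' in ap'.
have /arcS := arc_cat restrict_closed_under_concatenation Mdom IJ
  (arcS (@subsetT _ _) (@subset_refl _ _) ap') (arcS (@subsetT _ _) (@subset_refl _ _) be').
exact.
Qed.

(** The first step of the new chain is the limit of the concatenations of the
    short arc from [y'] to [p] with the first piece of the chain that starts at
    [b]; it lands near the end of that piece, and the old chain continues from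
    there.  Were no [delta] good enough, counterexamples for
    [delta = eps / 2 / (n + 1)] would have such a limit, and it would refute
    one of them. *)
Lemma chain_from_limit y tau eps : 0 < tau -> 0 < eps ->
  exists2 delta, 0 < delta & forall y' p b c,
    arc M setT `[0, tau] y' p -> `|y' - y| <= delta -> `|p - b| <= delta ->
    chain M setT `[tau, 2 * tau + 1] delta b c ->
    chain M setT `[tau, +oo[ eps y c.
Proof.
move=> tau0 eps0; apply: contrapT => no.
pose delta n := eps / 2 / n.+1%:R.
have e20 : 0 < eps / 2 by rewrite divr_gt0.
have delta0 n : 0 < delta n by rewrite divr_gt0.
have delta_le n : delta n <= eps / 2.
  by rewrite ler_pdivrMr// ler_peMr ?ler1n ?ltW.
pose bad n y' p b e v := [/\ arc M setT `[0, tau] y' p,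
  arc M setT `[tau, 2 * tau + 1] b e, `|y' - y| <= delta n,
  `|p - b| <= delta n & `|e - v| <= delta n] /\
  exists c, [/\ v = c \/ chain M setT `[tau, 2 * tau + 1] (delta n) v c &
               ~ chain M setT `[tau, +oo[ eps y c].
have /choice [w wP] n : exists w : 'rV_d * 'rV_d * 'rV_d * 'rV_d * 'rV_d,
    bad n w.1.1.1.1 w.1.1.1.2 w.1.1.2 w.1.2 w.2.
  apply: contrapT => nb; apply: no; exists (delta n) => // y' p b c ap ay pb.
  move=> /clos_trans_t1n_iff bc; apply: contrapT => nyc; apply: nb.
  case: bc nyc => [v [e be ev]|v v' [e be ev] /clos_trans_t1n_iff vc] nyc.
    exists (y', p, b, e, v); split=> //; exists v; split=> //; by left.
  exists (y', p, b, e, v); split=> //; exists v'; split=> //; by right.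
have [U [UU Uinf]] := @ultraFilterLemma nat \oo _.
have [a' [e' [acvg ecvg ae]]] : exists a' e' : 'rV[R]_d,
    [/\ (w n).1.1.1.1 @[n --> U] --> a', (w n).1.2 @[n --> U] --> e' &
        arc M setT `[tau, +oo[ a' e'].
  apply: (@arc_ulim_cat _ U `[0, tau] `[tau, 2 * tau + 1] _ (2 * tau + 1)
    _ (fun n => (w n).1.1.1.2) (fun n => (w n).1.1.2)).
  - exact: itv_closed.
  - exact: itv_closed.
  - by move=> l; rewrite /= in_itv /=; lra.
  - by move=> l; rewrite /= in_itv /= => /andP[].
  - by move=> l l'; rewrite /= !in_itv /=; lra.
  - by move=> n; have [[]] := wP n.
  - by move=> n; have [[]] := wP n.
  - apply: (@free_ultra_cvg R 'rV[R]_d U _ _ _ _ Uinf e20) => n; rewrite subr0.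
    by have [[]] := wP n.
have ycvg : (w n).1.1.1.1 @[n --> U] --> y.
  by apply: (@free_ultra_cvg R 'rV[R]_d U _ _ _ _ Uinf e20) => n; have [[]] := wP n.
have ay : a' = y by apply: (cvg_unique _ acvg ycvg); exact: norm_hausdorff.
have /cvgrPdist_le/(_ _ e20)/filter_ex [n en] := ecvg.
have [[_ _ _ _ ev] [c [vc []]]] := wP n.
have yv : step M setT `[tau, +oo[ eps y (w n).2.
  exists e'; first by rewrite -ay.
  rewrite -(subrKA (w n).1.2) (splitr eps); apply: le_trans (ler_normD _ _) _.
  by apply: lerD => //; exact: le_trans (delta_le n).
case: vc => [<-|vc]; first exact: t_step.
apply: t_trans (t_step _ _ _ _ yv) _; apply: chainS vc => //.
  by move=> l; rewrite /= !in_itv /=; lra.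
by apply: le_trans (delta_le n) _; lra.
Qed.

(** The mirror image of [chain_from_limit].  The new last step starts at the
    limit of the start points of the last pieces, so the piece before that one
    is redirected to land there; the detour through [b] guarantees that there
    is such a piece. *)
Lemma chain_to_limit y tau eps : 0 < tau -> 0 < eps ->
  exists2 delta, 0 < delta & forall c b a y',
    chain M setT `[tau, 2 * tau + 1] delta c b ->
    chain M setT `[tau, 2 * tau + 1] delta b a ->
    arc M setT `[0, tau] a y' -> `|y' - y| <= delta ->
    chain M setT `[tau, +oo[ eps c y.
Proof.
move=> tau0 eps0; apply: contrapT => no.
pose delta n := eps / 2 / n.+1%:R.
have e20 : 0 < eps / 2 by rewrite divr_gt0.
have delta0 n : 0 < delta n by rewrite divr_gt0.
have delta_le n : delta n <= eps / 2.
  by rewrite ler_pdivrMr// ler_peMr ?ler1n ?ltW.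
pose bad n v e a y' := [/\ arc M setT `[tau, 2 * tau + 1] v e,
  arc M setT `[0, tau] a y', `|e - a| <= delta n & `|y' - y| <= delta n] /\
  exists c, [/\ chain M setT `[tau, 2 * tau + 1] (delta n) c v &
               ~ chain M setT `[tau, +oo[ eps c y].
have /choice [w wP] n : exists w : 'rV_d * 'rV_d * 'rV_d * 'rV_d,
    bad n w.1.1.1 w.1.1.2 w.1.2 w.2.
  apply: contrapT => nb; apply: no; exists (delta n) => // c b a y' cb.
  move=> /clos_trans_tn1_iff ba ay yy; apply: contrapT => ncy; apply: nb.
  case: ba ay => [v [e be ev]|v v' [e be ev] /clos_trans_tn1_iff bv] ay.
    by exists (b, e, v, y'); split=> //; exists c.
  by exists (v, e, v', y'); split=> //; exists c; split=> //; exact: t_trans bv.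
have [U [UU Uinf]] := @ultraFilterLemma nat \oo _.
have [v' [y' [vcvg ycvg vy]]] : exists v' y' : 'rV[R]_d,
    [/\ (w n).1.1.1 @[n --> U] --> v', (w n).2 @[n --> U] --> y' &
        arc M setT `[tau, +oo[ v' y'].
  apply: (@arc_ulim_cat _ U `[tau, 2 * tau + 1] `[0, tau] _ (2 * tau + 1)
    _ (fun n => (w n).1.1.2) (fun n => (w n).1.2)).
  - exact: itv_closed.
  - exact: itv_closed.
  - by move=> l; rewrite /= in_itv /= => /andP[].
  - by move=> l; rewrite /= in_itv /=; lra.
  - by move=> l l'; rewrite /= !in_itv /=; lra.
  - by move=> n; have [[]] := wP n.
  - by move=> n; have [[]] := wP n.
  - apply: (@free_ultra_cvg R 'rV[R]_d U _ _ _ _ Uinf e20) => n; rewrite subr0.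
    by have [[]] := wP n.
have ycvg' : (w n).2 @[n --> U] --> y.
  by apply: (@free_ultra_cvg R 'rV[R]_d U _ _ _ _ Uinf e20) => n; have [[]] := wP n.
have yy : y' = y by apply: (cvg_unique _ ycvg ycvg'); exact: norm_hausdorff.
have /cvgrPdistC_le/(_ _ e20)/filter_ex [n vn] := vcvg.
have [_ [c [cv []]]] := wP n.
apply: (@t_trans _ _ _ v'); last first.
  by apply: t_step; exists y'; rewrite // yy subrr normr0 ltW.
rewrite (splitr eps); apply: chain_shift (ltW e20) _ vn.
apply: chainS cv => //.
by move=> l; rewrite /= !in_itv /=; lra.
Qed.

(** If the part of the piece after [y'] has length at least [tau] it is itself
    a step, and a trivial arc at [y'] plays the role of the short one.  If the
    part before [y'] is that long, its end is moved from [y'] to [y]. *)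
Lemma chain_recurrent_limit_on_cycle y :
  (forall tau delta, 0 < tau -> 0 < delta ->
     exists2 y', on_cycle M `[tau, +oo[ delta y' & `|y' - y| <= delta) ->
  forall tau eps, 0 < tau -> 0 < eps -> chain M setT `[tau, +oo[ eps y y.
Proof.
move=> cyc tau eps tau0 eps0.
have [delta1 delta10 from_y] := chain_from_limit y tau0 eps0.
have [delta2 delta20 to_y] := chain_to_limit y tau0 eps0.
pose delta := Num.min (Num.min delta1 delta2) (eps / 2).
have delta0 : 0 < delta by rewrite !lt_min delta10 delta20 divr_gt0.
have [[le1 le2] le3] : (delta <= delta1 /\ delta <= delta2) /\ delta <= eps / 2.
  by rewrite /delta !ge_min !lexx ?orbT.
have [y' [a [e [b [ay ye eb ab ba]]]] yy] := cyc tau delta tau0 delta0.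
have chop u v : chain M setT `[tau, +oo[ delta u v ->
    chain M setT `[tau, 2 * tau + 1] delta u v.
  by apply: chain_chop => //; [exact: restrict_tail_invariant|exact: ltW].
have widen delta' u v : delta <= delta' -> chain M setT `[tau, +oo[ delta u v ->
    chain M setT `[tau, 2 * tau + 1] delta' u v.
  by move=> dd' /chop; apply: chainS.
have aa : chain M setT `[tau, +oo[ delta a a by exact: t_trans ba.
apply: (@t_trans _ _ _ a).
  case: (arc_cases tau ye) => [ye'|ye'].
    exact: from_y ye' (le_trans yy le1) (le_trans eb le1) (widen _ _ _ le1 ba).
  have [phi [_ [_ [Mphi phi0 _ _ _]]]] := ye.
  apply: (from_y y' y' y'); rewrite ?subrr ?normr0 ?(le_trans yy) // ?ltW //.
    by apply: arc_refl (Mdom Mphi) _ _ _ => //; rewrite /= in_itv /= lexx ltW.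
  apply: widen => //; apply: t_trans ba; apply: t_step.
  by exists e.
case: (arc_cases tau ay) => [ay'|ay'].
  exact: to_y (widen _ _ _ le2 aa) (widen _ _ _ le2 aa) ay' (le_trans yy le2).
have : chain M setT `[tau, +oo[ delta a y'.
  apply: t_trans aa _; apply: t_step; exists y' => //.
  by rewrite subrr normr0 ltW.
move=> /(chain_shift (ltW delta0))/(_ yy); apply: chainS => //.
by rewrite (splitr eps); exact: lerD.
Qed.

(** The set [chain_recurrent_set L X], with its chains in relational form. *)
Let CR := [set y : 'rV[R]_d | X y /\ forall tau eps, 0 < tau -> 0 < eps ->
  chain M setT `[tau, +oo[ eps y y].

(** A limit of pieces of ever finer cycles lies inside the recurrent set by
    [chain_recurrent_limit_on_cycle].  The last clause lets a chain keep its
    start [x]: a limit point different from [x] is the limit of points that are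
    eventually different from [x]. *)
Lemma arc_shadow x tau eps : 0 < tau -> 0 < eps ->
  exists tau' delta, [/\ tau <= tau', 0 < delta, delta <= eps &
    forall a e, arc M (on_cycle M `[tau', +oo[ delta) `[tau, 2 * tau + 1] a e ->
    exists a' e', [/\ arc M CR `[tau, 2 * tau + 1] a' e', `|a - a'| <= eps,
      `|e - e'| <= eps & a = x -> a' = x]].
Proof.
move=> tau0 eps0; apply: contrapT => no.
pose delta n := eps / n.+1%:R.
pose bad n (w : 'rV[R]_d * 'rV[R]_d) :=
  arc M (on_cycle M `[tau + n%:R, +oo[ (delta n)) `[tau, 2 * tau + 1] w.1 w.2 /\
  ~ exists a' e', [/\ arc M CR `[tau, 2 * tau + 1] a' e', `|w.1 - a'| <= eps,
      `|w.2 - e'| <= eps & w.1 = x -> a' = x].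
have /choice [w wP] n : exists w, bad n w.
  apply: contrapT => nb; apply: no; exists (tau + n%:R), (delta n); split.
  - by rewrite lerDl.
  - by rewrite divr_gt0.
  - by rewrite ler_pdivrMr// ler_peMr ?ler1n ?ltW.
  - move=> a e ae; apply: contrapT => nae; apply: nb.
    by exists (a, e); split.
have [U [UU Uinf]] := @ultraFilterLemma nat \oo _.
have [a' [e' [acvg ecvg ae]]] := arc_ulim curvesL wellposedL compactX UU
  (@itv_closed _ _ tau (2 * tau + 1)) (B := 2 * tau + 1)
  (fun l (lI : [set` `[tau, 2 * tau + 1]] l) => (andP lI).2)
  (fun n => (wP n).1).
have ae_CR : arc M CR `[tau, 2 * tau + 1] a' e'.
  have [phi [t [j [Mphi phi0 phit It Kphi]]]] := ae.
  exists phi, t, j; split=> // s i z phis /(Kphi _ _ _ phis) Uz.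
  split; first exact: Mphi.2 phis.
  apply: chain_recurrent_limit_on_cycle => tau' delta' tau'0 delta'0.
  have zV : nbhs z [set y | `|y - z| <= delta'].
    by have /cvgrPdistC_le := @cvg_id _ (nbhs z); exact.
  have Utau : U [set n | tau' <= tau + n%:R].
    apply: Uinf; exists (Num.bound tau') => // n /= nt.
    apply: (@le_trans _ _ n%:R); last by rewrite lerDr ltW.
    apply: (@le_trans _ _ (Num.bound tau')%:R); last by rewrite ler_nat.
    by apply/ltW/archi_boundP/ltW.
  have Udelta : U [set n | delta n <= delta'].
    have de : 0 < delta' / eps by rewrite divr_gt0.
    apply: Uinf; have := near_infty_natSinv_lt (PosNum de).
    by apply: filterS => n /= /ltW; rewrite ler_pdivlMr// mulrC.
  have [n [[/= tn dn] [y [ycyc yz]]]] :=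
    filter_ex (filterI (filterI Utau Udelta) (Uz _ zV)).
  exists y => //; apply: on_cycleS ycyc => // l.
  by rewrite /= !in_itv /= !andbT; exact: le_trans.
have [n [an [en anx]]] : exists n, `|(w n).1 - a'| <= eps /\
    (`|(w n).2 - e'| <= eps /\ ((w n).1 = x -> a' = x)).
  apply: (@filter_ex _ U); apply: filterI; first by move/cvgrPdistC_le : acvg; exact.
  apply: filterI; first by move/cvgrPdistC_le : ecvg; exact.
  have [->|ax] := eqVneq a' x; first exact: filterS filterT.
  have ax0 : 0 < `|a' - x| by rewrite normr_gt0 subr_eq0.
  move/cvgrPdist_lt : acvg => /(_ _ ax0); apply: filterS => n /= + anx.
  by rewrite anx ltxx.
by have [_] := wP n; apply; exists a', e'.
Qed.

(** The shadows of consecutive pieces end and start within [eps / 3] of the two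
    sides of the old jump.  The induction leaves the target [b'] of the
    remaining chain open so that it can be the start of the next shadow. *)
Lemma chain_recurrent_internal x : CR x ->
  forall tau eps, 0 < tau -> 0 < eps -> chain M CR `[tau, +oo[ eps x x.
Proof.
move=> [_ recx] tau eps tau0 eps0.
have e30 : 0 < eps / 3 by rewrite divr_gt0.
have [tau' [delta [tt delta0 deltae shadow]]] := arc_shadow x tau0 e30.
have Mtail := restrict_tail_invariant.
have xx := recx tau' delta (lt_le_trans tau0 tt) delta0.
have {xx} := cycle_arcs_on_cycle Mtail Mdom xx xx.
have tauS : [set` `[tau', +oo[] `<=` [set` `[tau, +oo[].
  by move=> l; rewrite /= !in_itv /= !andbT; exact: le_trans.
move=> /(chainS (@subset_refl _ _) tauS (lexx _)).
move=> /(chain_chop Mtail Mdom tau0 (ltW delta0)).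
have lift a b e' a' e b' : arc M CR `[tau, 2 * tau + 1] a' e' ->
    `|e - e'| <= eps / 3 -> `|e - b| <= delta -> `|b - b'| <= eps / 3 ->
    chain M CR `[tau, +oo[ eps a' b'.
  move=> ae' ee eb bb; apply: t_step; exists e'.
    by apply: arcS ae' => // l; rewrite /= !in_itv /=; lra.
  have -> : e' - b' = (e' - e) + (e - b) + (b - b') by rewrite !addrA !subrK.
  apply: le_trans (ler_normD _ _) _; apply: le_trans (lerD (ler_normD _ _) bb) _.
  by rewrite (distrC e'); lra.
suff main a b :
    chain M (on_cycle M `[tau', +oo[ delta) `[tau, 2 * tau + 1] delta a b ->
    exists a', [/\ `|a - a'| <= eps / 3, a = x -> a' = x &
      forall b', `|b - b'| <= eps / 3 -> chain M CR `[tau, +oo[ eps a' b'].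
  move=> /main [x' [_ xx']]; rewrite xx' //; apply.
  by rewrite subrr normr0 ltW.
move=> /clos_trans_t1n_iff; elim=> {a b} [a b|a c b] [e].
  move=> /shadow [a' [e' [ae' aa ee ax]]] eb; exists a'; split=> // b'.
  exact: lift ae' ee eb.
move=> /shadow [a' [e' [ae' aa ee ax]]] ec _ [c' [cc _ cb]].
exists a'; split=> // b' bb; apply: t_trans (cb _ bb).
exact: lift ae' ee ec cc.
Qed.

End Recurrence.

(** * Chains as finite sequences *)

Lemma clos_trans_seqP (T : Type) (r : relation T) (x y : T) :
  clos_trans T r x y <->
  exists (n : nat) (xs : nat -> T),
    [/\ (0 < n)%N, xs 0%N = x, xs n = y &
        forall k, (k < n)%N -> r (xs k) (xs k.+1)].
Proof.
split=> [/clos_trans_t1n_iff|[n [xs [n0 <- <- xsP]]]].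
  elim=> {x y} [x y xy|x z y xz _ [n [xs [n0 xs0 xsn xsP]]]].
    by exists 1%N, (fun k => if k is 0%N then x else y); split=> // -[].
  exists n.+1, (fun k => if k is k'.+1 then xs k' else x); split=> //.
  by case=> [_|k]; [rewrite xs0|exact: xsP].
case: n n0 xsP => // n _; elim: n => [|n IH] xsP; first exact/t_step/xsP.
apply: t_trans (t_step _ _ _ _ (xsP n.+1 _)) => //.
by apply: IH => k kn; apply: xsP; exact: leqW.
Qed.

Section ChainExists.
Context (R : realType) (d : nat).
Implicit Types (M L : set (hcurve R d)) (K : set 'rV[R]_d).

Lemma chain_exists_chain M tau eps x y :
  chain_exists M tau eps x y -> chain M setT `[tau, +oo[ eps x y.
Proof.
move=> [n [xs [phis [ts [js [n0 xs0 xsn xsP]]]]]].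
apply/clos_trans_seqP; exists n, xs; split=> // k kn.
have [Mphi phi0 phit taut eb] := xsP k kn.
exists (hval (phis k) (ts k) (js k)); last first.
  by rewrite distrC; exact: le_trans (norm_le_enorm _) eb.
exists (phis k), (ts k), (js k); split=> //; last by rewrite /= in_itv /= taut.
by move: phit; rewrite /hdom /hval /=; case: (phis k _ _).
Qed.

Lemma chain_internal_chain_exists M L K tau eps x : M `<=` L -> K x ->
  chain M K `[tau, +oo[ (eps / d.+1%:R) x x ->
  internal_chain_exists K L tau eps x x.
Proof.
move=> ML Kx /clos_trans_seqP [n [xs [n0 xs0 xsn xsP]]].
have /choice [w wP] k : exists w : hcurve R d * R * nat, (k < n)%N ->
    [/\ L w.1.1, w.1.1 0 0%N = Some (xs k), hdom w.1.1 (w.1.2, w.2),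
        tau <= w.1.2 + w.2%:R & eball (hval w.1.1 w.1.2 w.2) eps (xs k.+1)] /\
    forall s i z, w.1.1 s i = Some z -> s + i%:R <= w.1.2 + w.2%:R -> K z.
  have [kn|] := ltnP k n; last by exists (fun _ _ => None, 0, 0%N).
  have [e [phi [t [j [Mphi phi0 phit + Kphi]]]] eb] := xsP k kn.
  rewrite /= in_itv /= andbT => taut; exists (phi, t, j) => _; split=> //.
  split=> //; [exact: ML|by rewrite /hdom /= phit|].
  rewrite /eball /= /hval phit /=; apply: le_trans (enorm_le_norm _) _.
  by rewrite mulrC -ler_pdivlMr// distrC.
exists n, xs, (fun k => (w k).1.1), (fun k => (w k).1.2), (fun k => (w k).2).
split; split=> // k kn; first by have [] := wP k kn.
by move=> s i z phis /andP[_]; exact: (wP k kn).2 phis.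
Qed.

End ChainExists.

Theorem theorem2p8 (R : realType) (d : nat) (L : set (hcurve R d))
    (X : set 'rV[R]_d)
    (curvesL : forall phi, L phi -> hybrid_curve phi)
    (wellposedL : nominally_well_posed L)
    (tailL : tail_invariant L)
    (concatL : closed_under_concatenation L)
    (X_neq0 : X !=set0) (compactX : compact X) :
  internally_chain_recurrent L (chain_recurrent_set L X).
Proof.
move=> x Rx tau eps tau0 eps0.
have RE : chain_recurrent_set L X =
    [set y | X y /\ forall tau eps, 0 < tau -> 0 < eps ->
       chain (restrict_to L X) setT `[tau, +oo[ eps y y].
  apply/seteqP; split=> y [Xy ycr]; split=> // tau' eps' tau'0 eps'0.
    exact/chain_exists_chain/ycr.
  have [|||n [xs [phis [ts [js [ch _]]]]]] :=
    @chain_internal_chain_exists _ _ (restrict_to L X) (restrict_to L X) setT tau' eps' y.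
  - by [].
  - by [].
  - by apply: ycr => //; rewrite divr_gt0.
  by exists n, xs, phis, ts, js.
apply: (@chain_internal_chain_exists _ _ (restrict_to L X)) => //.
  by move=> phi [].
move: Rx; rewrite RE => Rx.
by apply: chain_recurrent_internal => //; rewrite divr_gt0.
Qed.
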